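(* There exist a complete class $\mathfrak{X}$ of finite groups, a finite group $G$ with a normal series $G=G_0\geqslant G_1\geqslant\dots\geqslant G_n=1$ (that is, $G_i\trianglelefteq G$ for each $i$), a maximal $\mathfrak{X}$-subgroup $H$ of $G$, a subgroup $K_*\leqslant H$, and an $\mathfrak{X}$-subgroup $K\leqslant G$ such that $K$ and $K_*$ have the same projections onto the sections of the series, i.e. $(K\cap G_{i-1})G_i/G_i=(K_*\cap G_{i-1})G_i/G_i$ for each $i=1,\dots,n$, but $K$ is not conjugate in $G$ to any subgroup of $H$.
   Context: All groups are finite. A nonempty class $\mathfrak{X}$ of finite groups is called complete if it is closed under taking subgroups, homomorphic images (in particular, isomorphic copies), and extensions (if $N\trianglelefteq A$ with $N\in\mathfrak{X}$ and $A/N\in\mathfrak{X}$, then $A\in\mathfrak{X}$). An $\mathfrak{X}$-subgroup of $G$ is a subgroup belonging to $\mathfrak{X}$. A maximal $\mathfrak{X}$-subgroup of $G$ is an $\mathfrak{X}$-subgroup of $G$ that is maximal with respect to inclusion among the $\mathfrak{X}$-subgroups of $G$. *)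

(* Defs.v *)
From mathcomp Require Import all_boot all_fingroup.

Set Implicit Arguments.
Unset Strict Implicit.
Unset Printing Implicit Defensive.

Import GroupScope.

(* A finite group is a subgroup G : {group gT} of an arbitrary finite ambient
   group type gT; complete classes are invariant under isomorphism, hence
   insensitive to the choice of gT. *)
Definition group_class := forall gT : finGroupType, {group gT} -> Prop.

Record complete_class (X : group_class) : Prop := CompleteClass {
  complete_nonempty : exists (gT : finGroupType) (G : {group gT}), X gT G;
  complete_subgroup : forall (gT : finGroupType) (G H : {group gT}),
    H \subset G -> X gT G -> X gT H;
  complete_morphim :
    forall (aT rT : finGroupType) (G : {group aT}) (f : {morphism G >-> rT}),
    X aT G -> X rT (f @* G)%G;
  complete_extension : forall (gT : finGroupType) (A N : {group gT}),
    N <| A -> X gT N -> X (coset_of N) (A / N)%G -> X gT A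
}.

Definition class_subgroup (X : group_class) (gT : finGroupType)
    (G H : {group gT}) : Prop :=
  H \subset G /\ X gT H.

Definition maximal_class_subgroup (X : group_class) (gT : finGroupType)
    (G H : {group gT}) : Prop :=
  class_subgroup X G H /\
  (forall L : {group gT}, class_subgroup X G L -> H \subset L -> L :=: H).

(* Only the terms Gs 0, ..., Gs n of Gs are relevant. *)
Definition normal_series (gT : finGroupType) (G : {group gT}) (n : nat)
    (Gs : nat -> {group gT}) : Prop :=
  [/\ Gs 0 :=: G, Gs n :=: 1,
      forall i : nat, i < n -> Gs i.+1 \subset Gs i
    & forall i : nat, i <= n -> Gs i <| G].

(* The projection of K onto the section Gs i / Gs i.+1 of a normal
   series of G; for K \subset G the numerator normalises Gs i.+1, so that the
   library quotient A / N, which is the image of A :&: 'N(N), loses nothing. *)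
Definition section_proj (gT : finGroupType) (Gs : nat -> {group gT})
    (K : {group gT}) (i : nat) : {set coset_of (Gs i.+1)} :=
  ((K :&: Gs i) * Gs i.+1) / Gs i.+1.

(* Main.v *)
(* For an X-subgroup M of B and a maximal X-subgroup S of B, the direct product
   M x S is a maximal X-subgroup of M x B.  The diagonal of M and M x 1 have the
   same projections on the sections of M x B >= 1 x B >= 1, but if the diagonal
   is conjugate into M x S then M is conjugate in B into S.
   With X the solvable groups and B = Alt_5, let S contain an element of order 3
   and M have order 5: a solvable subgroup of Alt_5 has order not divisible by
   15, since otherwise Alt_5 would act faithfully on at most 4 cosets. *)
Require Import Defs.
From mathcomp Require Import all_boot all_fingroup all_solvable.

Set Implicit Arguments.
Unset Strict Implicit.
Unset Printing Implicit Defensive.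

Import GroupScope.

(** Closure under images is assumed only for morphisms defined exactly on the group; restricting [f]
    to [G] reduces to that case. *)
Lemma class_morphim_sub (X : group_class) (aT rT : finGroupType)
    (D G : {group aT}) (f : {morphism D >-> rT}) :
  complete_class X -> G \subset D -> X aT G -> X rT (f @* G)%G.
Proof.
move=> cX sGD XG; have := complete_morphim cX (restrm_morphism sGD f) XG.
by congr (X _ _); apply: group_inj; rewrite /= morphim_restrm setIid.
Qed.

(** The product is an extension of 1 x B, an image of [B], by a quotient that is an image of [A]. *)
Lemma class_setX (X : group_class) (aT bT : finGroupType)
    (A : {group aT}) (B : {group bT}) :
  complete_class X -> X aT A -> X bT B -> X _ (setX_group A B).
Proof.
move=> cX XA XB.
have /dprodP[_ defAB _ _] := setX_dprod A B.
have nsBAB: setX_group 1 B <| setX_group A B.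
  by have /dprod_normal2[_] := setX_dprod A B.
have XA1: X _ (pairg1 bT @* A)%G by apply: class_morphim_sub; rewrite ?subsetT.
have X1B: X _ (setX_group [1 aT]%G B).
  have: X _ (@pair1g aT bT @* B)%G by apply: class_morphim_sub; rewrite ?subsetT.
  by congr (X _ _); apply: group_inj; rewrite /= morphim_pair1g.
apply: (complete_extension cX nsBAB X1B).
have ->: (setX_group A B / setX_group 1 B)%G
       = (coset (setX_group 1 B) @* (pairg1 bT @* A))%G.
  by apply: group_inj; rewrite /= morphim_pairg1 -defAB quotientMidr.
apply: class_morphim_sub => //.
rewrite /= morphim_pairg1; apply: subset_trans (normal_norm nsBAB).
by rewrite /= setXS ?sub1G.
Qed.

(** An X-subgroup of A x B containing A x S projects to an X-subgroup of [B] containing [S], hence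
    onto [S] by maximality, so it lies in A x S. *)
Lemma maximal_class_setX (X : group_class) (aT bT : finGroupType)
    (A : {group aT}) (B S : {group bT}) :
  complete_class X -> X aT A -> maximal_class_subgroup X B S ->
  maximal_class_subgroup X (setX_group A B) (setX_group A S).
Proof.
move=> cX XA [[sSB XS] maxS]; split=> [|L [sLAB XL] sASL].
  by split; [rewrite /= setXS | apply: class_setX].
have defS: snd @* L = S.
  apply: (maxS (_ @* L)%G).
    split; last by apply: class_morphim_sub; rewrite ?subsetT.
    by rewrite /= -(morphim_sndX A B) morphimS.
  by rewrite /= -(morphim_sndX A S) morphimS.
apply/eqP; rewrite eqEsubset sASL andbT; apply/subsetP=> x Lx.
have:= subsetP sLAB x Lx; rewrite !inE => /andP[-> _] /=.
by rewrite -defS (mem_morphim (@snd_morphism aT bT)) ?inE.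
Qed.

Definition diag {gT : finGroupType} (x : gT) := (x, x).

Lemma diagM (gT : finGroupType) : {morph @diag gT : x y / x * y}.
Proof. by []. Qed.

Canonical diag_morphism (gT : finGroupType) :=
  @Morphism _ _ setT (@diag gT) (in2W (@diagM gT)).

Lemma mem_diag (gT : finGroupType) (M : {group gT}) (x y : gT) :
  ((x, y) \in diag @* M) = (x \in M) && (y == x).
Proof.
apply/morphimP/andP=> [[z _ Mz [-> ->]] | [Mx /eqP->]]; first by rewrite Mz eqxx.
by exists x; rewrite ?inE.
Qed.

(** The factorisation (x, y) = (x, x)(1, x^-1 y) shows that the diagonal, like M x 1, covers the top
    section. *)
Lemma diag_mul_set1X (gT : finGroupType) (M B : {group gT}) :
  M \subset B -> diag @* M * setX 1 B = setX M B.
Proof.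
move=> sMB; apply/eqP; rewrite eqEsubset; apply/andP; split.
  rewrite (mul_subG (G := setX_group M B)) //= ?setXS ?sub1G //.
  apply/subsetP=> -[x y]; rewrite mem_diag inE => /andP[Mx /eqP->] /=.
  by rewrite Mx (subsetP sMB).
apply/subsetP=> -[x y] /[!inE]/= /andP[Mx By].
have ->: (x, y) = (x, x) * (1, x^-1 * y).
  by congr (_, _) => /=; rewrite ?mulg1 ?mulKVg.
rewrite mem_mulg ?mem_diag ?Mx //= !inE eqxx /=.
by rewrite groupM // groupV (subsetP sMB).
Qed.

Lemma diagI_set1X (gT : finGroupType) (M B : {group gT}) :
  diag @* M :&: setX 1 B = 1.
Proof.
apply/trivgP/subsetP=> -[x y]; rewrite !(mem_diag, inE) /=.
by case/andP=> /andP[_ /eqP->] /andP[/eqP-> _].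
Qed.

Lemma diag_counterexample (X : group_class) (gT : finGroupType)
    (B M S : {group gT}) :
  complete_class X -> class_subgroup X B M -> maximal_class_subgroup X B S ->
  (forall b, b \in B -> ~~ (M :^ b \subset S)) ->
  exists (G : {group gT * gT}) (n : nat) (Gs : nat -> {group gT * gT})
         (H Kstar K : {group gT * gT}),
    normal_series G n Gs /\
    maximal_class_subgroup X G H /\
    Kstar \subset H /\
    class_subgroup X G K /\
    (forall i : nat, i < n -> section_proj Gs K i = section_proj Gs Kstar i) /\
    (forall L : {group gT * gT}, L \subset H ->
       ~ (exists2 g, g \in G & K :^ g = L)).
Proof.
move=> cX [sMB XM] maxS nMS.
pose N := setX_group [1 gT]%G B; pose G := setX_group M B.
(* Index 2 is past the end of the list, so the default value supplies the last term 1 of the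
   series. *)
pose Gs i := nth 1%G [:: G; N] i.
have nsNG: N <| G by have /dprod_normal2[_] := setX_dprod M B.
have sMG: setX M 1 \subset G by rewrite setXS ?sub1G.
have sKG: diag @* M \subset G.
  by rewrite /G /= -(diag_mul_set1X sMB) mulg_subl ?group1.
exists G, 2, Gs, (setX_group M S), (setX_group M 1), (diag @* M)%G.
split; [|split; [|split; [|split; [|split]]]].
- split=> // -[|[|[|i]]] //= _; rewrite ?sub1G ?normal1 ?normal_refl //.
  exact: normal_sub nsNG.
- exact: maximal_class_setX.
- by rewrite /= setXS ?sub1G.
- by split=> //; apply: class_morphim_sub; rewrite ?subsetT.
(* On the top section both products with [N] are all of M x B; on the bottom one both intersections
   with [N] are trivial. *)
- case=> [|[|i]] // _; rewrite /section_proj /=.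
    by rewrite (setIidPl sKG) (setIidPl sMG) diag_mul_set1X // setX_prod.
  by have /dprodP[_ _ _ /= MI1] := setX_dprod M B; rewrite diagI_set1X MI1.
(* The second component of (x, x) ^ (a, b) is [x ^ b], so a conjugate of the diagonal inside M x S
   forces [M :^ b] into [S]. *)
move=> L sLH [[a b] /[!inE]/= /andP[_ Bb] defL].
case/negP: (nMS b Bb); apply/subsetP=> _ /imsetP[x Mx ->].
have: (x, x) ^ (a, b) \in L.
  by rewrite -defL memJ_conjg mem_diag Mx eqxx.
by move/(subsetP sLH); rewrite !inE => /andP[].
Qed.

Definition solvable_class : group_class := fun gT G => solvable G.

Lemma solvable_complete : complete_class solvable_class.
Proof.
split=> [|gT G H sHG|aT rT G f|gT A N nsNA solN solAN].
- by exists {perm unit}, 1%G; apply: solvable1.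
- exact: solvableS.
- exact: morphim_sol.
- by rewrite /solvable_class (series_sol nsNA) solN.
Qed.

(** The core of [H] is a proper normal subgroup of [G], hence trivial, so [G] embeds in the
    symmetric group on the cosets of [H]. *)
Lemma simple_card_dvd_indexf (gT : finGroupType) (G H : {group gT}) :
  simple G -> H \proper G -> #|G| %| #|G : H|`!.
Proof.
move=> /simpleP[_ simG] /andP[sHG nsGH].
have core1: gcore H G = 1.
  have [//|defG] := simG _ (gcore_normal sHG).
  by case/negP: nsGH; rewrite -defG gcore_sub.
have nHG : actby_cond G (rcosets H G) 'Rs by apply: actsRs_rcosets.
have faithG: [faithful G, on rcosets H G | 'Rs].
  by rewrite /faithful astabRs_rcosets core1 subsetIr.
rewrite (card_isog (isom_isog _ _ (faithful_isom nHG faithG))) ?subxx //.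
(* The restricted action fixes every set that is not a coset of [H], so its permutations lie in the
   symmetric group on the cosets. *)
rewrite -perm.card_Sym cardSg //; apply/subsetP=> _ /morphimP[x Gx _ ->].
rewrite inE; apply/subsetP=> Hy; rewrite inE; apply: contraR => notHy.
by rewrite actpermE /= /actby (negPf notHy).
Qed.

Lemma alt5_card_solvable (S : {group {perm 'I_5}}) :
  S \subset 'Alt_('I_5) -> solvable S -> ~~ (15 %| #|S|).
Proof.
have simA: simple 'Alt_('I_5) by apply: simple_Alt5; rewrite card_ord.
have cardA: #|'Alt_('I_5)| = 60.
  by apply/eqP; rewrite -(eqn_pmul2l (isT : 0 < 2)) card_Alt ?card_ord.
move=> sSA solS; apply/negP=> /dvdnP[k cardS].
have ltSA: S \proper 'Alt_('I_5).
  rewrite properEneq sSA andbT; apply: contraTneq solS => /group_inj->.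
  by rewrite solvable_AltF ?card_ord.
have := simple_card_dvd_indexf simA ltSA; rewrite cardA.
have := Lagrange sSA; rewrite cardS cardA.
case: k {cardS} => [|k] //; move: #|_ : _| => i.
(* For an index at most 4, 60 does not divide its factorial; a larger index times a positive
   multiple of 15 exceeds 60. *)
case: i => [|[|[|[|[|i]]]]] // /eqP.
by rewrite -mulnA -[60]/(4 * 15)%N mulnCA mulnC eqn_pmul2r //; case: k.
Qed.

Theorem mainTheorem4 :
  exists (X : group_class) (gT : finGroupType) (G : {group gT}) (n : nat)
         (Gs : nat -> {group gT}) (H Kstar K : {group gT}),
    complete_class X /\
    normal_series G n Gs /\
    maximal_class_subgroup X G H /\
    Kstar \subset H /\
    class_subgroup X G K /\
    (forall i : nat, i < n -> section_proj Gs K i = section_proj Gs Kstar i) /\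
    (forall L : {group gT}, L \subset H ->
       ~ (exists2 g : gT, g \in G & K :^ g = L)).
Proof.
exists solvable_class, ({perm 'I_5} * {perm 'I_5})%type.
pose B := 'Alt_('I_5)%G.
have dvdB d: d %| 60 -> d %| #|B|.
  congr (_ %| _); apply/eqP.
  by rewrite -(eqn_pmul2l (isT : 0 < 2)) card_Alt ?card_ord.
have [x Bx ox] := @Cauchy _ 3 B isT (dvdB 3 isT).
have [y By oy] := @Cauchy _ 5 B isT (dvdB 5 isT).
pose solB (S : {group {perm 'I_5}}) := (S \subset B) && solvable S.
have solx: solB <[x]>%G.
  by rewrite /solB /= cycle_subG Bx abelian_sol ?cycle_abelian.
(* Enlarging [<[x]>] to a maximal solvable subgroup of [B] ensures that 3 divides the order of
   [S]. *)
have [S /maxgroupP[/andP[sSB solS] maxS]] := maxgroup_exists solx.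
rewrite cycle_subG => Sx.
have [||b Bb|G [n [Gs [H [Ks [K ?]]]]]] :=
  @diag_counterexample solvable_class _ B <[y]>%G S solvable_complete.
- by split; rewrite ?cycle_subG // /solvable_class abelian_sol ?cycle_abelian.
- split=> // L [sLB solL] sSL.
  by apply: maxS => //; rewrite /solB sLB.
(* A conjugate of [<[y]>] inside [S] would make 5, and hence 15, divide the order of [S]. *)
- apply: contra (alt5_card_solvable sSB solS) => syS.
  have dvdx: #[x] %| #|S| by rewrite order_dvdG.
  have dvdy: #[y] %| #|S| by rewrite orderE -(cardJg <[y]> b) cardSg.
  by rewrite ox in dvdx; rewrite oy in dvdy; rewrite (@Gauss_dvd 3 5) // dvdx.
by exists G, n, Gs, H, Ks, K; split; first exact: solvable_complete.
Qed.
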